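(* Suppose $C$ and $\Phi$ satisfy the standing assumptions (S1)–(S3) and the assumptions (A1), (A2), (A3) listed in the context, with constants $L$ and $\zeta$, and let $T>0$ be such that $T^2(L+1)\le\frac{\zeta}{L+1}$. Let $P$ be the transition kernel of exact pHMC on $\mathcal{H}^l$, i.e. $P(q,\cdot)$ is the law of the position component of $\varphi_T(q,v)$ with $v\sim\mathcal{N}(0,C)$. Let $\mathcal{W}^1$ be the $L^1$-Wasserstein distance on probability measures on $\mathcal{H}^l$ with respect to the metric $\|x-y\|_l$. Then for any two probability distributions $\mu,\nu$ on $\mathcal{H}^l$ and every $n\in\mathbb{N}$, $$\mathcal{W}^1(\mu P^n,\nu P^n)\le\left(1-\tfrac{1}{27}\zeta T^2\right)^n\mathcal{W}^1(\mu,\nu).$$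
   Context: Spaces. $(\mathcal{H},\langle\cdot,\cdot\rangle)$ is a real separable infinite-dimensional Hilbert space, $\pi_0=\mathcal{N}(0,C)$ a centred Gaussian measure on it with injective covariance operator $C$; $\{\phi_j\}_{j\ge1}$ is an orthonormal eigenbasis, $C\phi_j=\lambda_j^2\phi_j$, $\lambda_j>0$. For $s\in\mathbb{R}$, $\mathcal{H}^s$ is the Hilbert space obtained by completing the span of the $\phi_j$ with respect to $\langle f,g\rangle_s=\sum_{j\ge1} j^{2s}\langle f,\phi_j\rangle\langle g,\phi_j\rangle$, with norm $\|\cdot\|_s$; $\mathcal{H}^{-s}$ is identified with the dual of $\mathcal{H}^s$ via the extension of $\langle\cdot,\cdot\rangle$. $C$ acts diagonally on all these spaces. Standing assumptions. (S1) There is $\kappa>\frac12$ with $0<\liminf_j j^\kappa\lambda_j\le\limsup_j j^\kappa\lambda_j<\infty$. (S2) There is a fixed $l\in[0,\kappa-\frac12)$ such that $\Phi:\mathcal{H}^l\to\mathbb{R}$ is continuous and its Fréchet derivative $D\Phi:\mathcal{H}^l\to\mathcal{H}^{-l}$ is globally Lipschitz. (S3) For every $\epsilon>0$ there is $K(\epsilon)\in\mathbb{R}$ with $\Phi(q)\ge K(\epsilon)-\epsilon\|q\|_l^2$ for all $q\in\mathcal{H}^l$. Under (S1), $\pi_0(\mathcal{H}^l)=1$, and under (S1)–(S2), $C\,D\Phi$ maps $\mathcal{H}^l$ to $\mathcal{H}^l$ and is Lipschitz. Further assumptions. (A1) $L>0$ and $L'\ge 0$ are constants such that for all $q,q'\in\mathcal{H}^l$: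 $\|D\Phi(q)-D\Phi(q')\|_{-l}\le L\|q-q'\|_l$, $\|C D\Phi(q)-C D\Phi(q')\|_l\le L\|q-q'\|_l$, $\|D\Phi(q)\|_{-l}\le L\|q\|_l+L'$, and $\|C D\Phi(q)\|_l\le L\|q\|_l+L'$. (A2) $\zeta>0$ is a constant with $\zeta\le L+1$ such that for all $x,y\in\mathcal{H}^l$: $\langle x-y,x-y\rangle_l+\langle C D\Phi(x)-C D\Phi(y),x-y\rangle_l\ge\zeta\|x-y\|_l^2$. (A3) $\Phi:\mathcal{H}^l\to\mathbb{R}$ is $C^4$, and there are constants $M,N_\Phi$ such that for all $x,y\in\mathcal{H}^l$: $\|D^2\Phi(x)-D^2\Phi(y)\|_{\mathcal{H}^l\to\mathcal{H}^{-l}}\le M\|x-y\|_l$ (i.e. $\|D^3\Phi\|\le M$), $\|C D^2\Phi(x)-C D^2\Phi(y)\|_{\mathcal{H}^l\to\mathcal{H}^{l}}\le M\|x-y\|_l$, and $\|D^4\Phi(x)\|\le N_\Phi$ (norm as a multilinear form on $\mathcal{H}^l$). Exact flow. $\varphi_t:\mathcal{H}^l\times\mathcal{H}^l\to\mathcal{H}^l\times\mathcal{H}^l$ is the flow of $\frac{dq}{dt}=v,\ \frac{dv}{dt}=-q-C D\Phi(q)$. *)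

(* Defs.v *)
From HB Require Import structures.
From mathcomp Require Import all_boot all_order all_algebra.
From mathcomp Require Import sesquilinear.
From mathcomp Require Import all_classical all_reals all_analysis.
From mathcomp Require Import ring lra.

Set Implicit Arguments.
Unset Strict Implicit.
Unset Printing Implicit Defensive.

Import Order.TTheory GRing.Theory Num.Theory.
Import numFieldNormedType.Exports.

Local Open Scope classical_set_scope.
Local Open Scope ring_scope.

(* The scale H^s.  An element of H^s is represented by its sequence of
   coefficients <f, phi_j> in the eigenbasis; the completion of the span of the
   phi_j for <f, g>_s = \sum_j j^(2s) <f, phi_j> <g, phi_j> is then the weighted
   sequence space [hs R s] below ([hs_complete], [hs_expansion]).  The
   mathematical index j >= 1 is j.+1 here: phi 0, lam 0 stand for phi_1,
   lambda_1. *)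
Section weighted_sequences.
Context {R : realType} (s : R).
Implicit Types (x y z : nat -> R) (a : R).

Definition hweight (j : nat) : R := j.+1%:R `^ (2 * s).

Definition hterm x y : R^nat := fun j => hweight j * x j * y j.

Definition in_hs : {pred (nat -> R)} :=
  fun x => `[< cvgn (series (hterm x x)) >].

Definition hdot_seq x y : R := limn (series (hterm x y)).

Lemma hweight_gt0 j : 0 < hweight j.
Proof. by rewrite powR_gt0. Qed.

Lemma hterm_ge0 x j : 0 <= hterm x x j.
Proof. by rewrite /hterm/= -mulrA mulr_ge0 ?(ltW (hweight_gt0 _))// -expr2 sqr_ge0. Qed.

Lemma hterm_cvg x y : x \in in_hs -> y \in in_hs ->
  cvgn (series (hterm x y)).
Proof.
move=> /asboolP cx /asboolP cy; apply: (@normed_cvg _ R^o).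
apply: (@series_le_cvg _ _ (hterm x x + hterm y y)).
- by move=> n /=.
- by move=> n; rewrite addr_ge0 ?hterm_ge0.
- move=> n; rewrite {1}/hterm/= -mulrA normrM gtr0_norm ?hweight_gt0//.
  rewrite [leRHS](_ : _ = hweight n * (x n * x n + y n * y n)); last first.
    by rewrite mulrDr !mulrA.
  rewrite ler_wpM2l ?(ltW (hweight_gt0 _))//.
  rewrite ler_norml; apply/andP; split; nra.
- exact: is_cvg_seriesD.
Qed.

Lemma hterm_symm x y : hterm x y = hterm y x.
Proof. by apply/funext => j; rewrite /hterm mulrAC. Qed.

Lemma htermDr x y z : hterm x (y + z) = hterm x y + hterm x z.
Proof. by apply/funext => j; rewrite /hterm -mulrDr. Qed.

Lemma htermZr a x y : hterm x (a *: y) = a *: hterm x y.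
Proof. by apply/funext => j; rewrite /hterm /GRing.scale/= mulrCA. Qed.

Lemma hterm0r x : hterm x 0 = 0.
Proof. by apply/funext => j; rewrite /hterm mulr0. Qed.

Fact in_hs_submod_closed : submod_closed in_hs.
Proof.
split.
  apply/asboolP; rewrite hterm0r.
  rewrite (_ : series _ = cst 0); first exact: is_cvg_cst.
  by apply/funext => n; rewrite /series/= big1.
move=> a x y xh yh; apply/asboolP.
have cxy := hterm_cvg xh yh; have cyx := hterm_cvg yh xh.
move: xh yh => /asboolP cx /asboolP cy.
rewrite htermDr htermZr (hterm_symm _ x) (hterm_symm _ y).
rewrite !htermDr !htermZr.
by apply: is_cvg_seriesD; [apply: is_cvg_seriesZ|];
  apply: is_cvg_seriesD => //; apply: is_cvg_seriesZ.
Qed.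

HB.instance Definition _ :=
  GRing.isSubmodClosed.Build R (nat -> R) in_hs in_hs_submod_closed.

Record hs : Type := Hs { hs_coef :> nat -> R ; hs_coefP : hs_coef \in in_hs }.

HB.instance Definition _ := [isSub for hs_coef].
HB.instance Definition _ := [Choice of hs by <:].
HB.instance Definition _ := [SubChoice_isSubLmodule of hs by <:].

Definition hdot (f g : hs) : R := hdot_seq f g.

Definition hnorm (f : hs) : R := Num.sqrt (hdot f f).

Lemma hdot_cvg (f g : hs) : cvgn (series (hterm f g)).
Proof. by apply: hterm_cvg; exact: hs_coefP. Qed.

Lemma hdotC (f g : hs) : hdot f g = hdot g f.
Proof. by rewrite /hdot /hdot_seq hterm_symm. Qed.

Lemma hdotDr (f g h : hs) : hdot f (g + h) = hdot f g + hdot f h.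
Proof.
by rewrite /hdot /hdot_seq htermDr lim_seriesD//; exact: hdot_cvg.
Qed.

Lemma hdotZr a (f g : hs) : hdot f (a *: g) = a * hdot f g.
Proof.
by rewrite /hdot /hdot_seq htermZr lim_seriesZ//; exact: hdot_cvg.
Qed.

Lemma hdot_ge0 (f : hs) : 0 <= hdot f f.
Proof.
apply: limr_ge; first exact: hdot_cvg.
by near=> n; apply: sumr_ge0 => j _; exact: hterm_ge0.
Unshelve. all: by end_near. Qed.

Lemma hdot_eq0 (f : hs) : hdot f f = 0 -> f = 0.
Proof.
move=> f0; apply/val_inj/funext => j /=; apply/eqP; rewrite -sqrf_eq0.
have : hterm f f j <= 0.
  rewrite -f0; apply: limr_ge; first exact: hdot_cvg.
  near=> n; rewrite /series/=.
  have jn : (j < n)%N by near: n; exact: nbhs_infty_gt.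
  rewrite big_mkord (bigD1 (Ordinal jn))//= lerDl.
  by apply: sumr_ge0 => i _; exact: hterm_ge0.
rewrite /hterm/= -mulrA -expr2 pmulr_rle0 ?hweight_gt0// => fj0.
by rewrite eq_le fj0 sqr_ge0.
Unshelve. all: by end_near. Qed.

Lemma hnorm_sqr (f : hs) : hnorm f ^+ 2 = hdot f f.
Proof. by rewrite sqr_sqrtr ?hdot_ge0. Qed.

Lemma hnormZ a (f : hs) : hnorm (a *: f) = `|a| * hnorm f.
Proof.
by rewrite /hnorm hdotZr hdotC hdotZr mulrA -expr2 sqrtrM ?sqr_ge0// sqrtr_sqr.
Qed.

Lemma hnorm0_eq0 (f : hs) : hnorm f = 0 -> f = 0.
Proof. by move=> f0; apply: hdot_eq0; rewrite -hnorm_sqr f0 expr0n. Qed.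

Lemma hdot_le_norm (f g : hs) : hdot f g <= hnorm f * hnorm g.
Proof.
have [/hnorm0_eq0 ->|f0] := eqVneq (hnorm f) 0.
  by rewrite hdotC -(scale0r (0 : hs)) hdotZr mul0r mulr_ge0 ?sqrtr_ge0.
have [/hnorm0_eq0 ->|g0] := eqVneq (hnorm g) 0.
  by rewrite -(scale0r (0 : hs)) hdotZr mul0r mulr_ge0 ?sqrtr_ge0.
have fp : 0 < hnorm f by rewrite lt_def f0 sqrtr_ge0.
have gp : 0 < hnorm g by rewrite lt_def g0 sqrtr_ge0.
have := hdot_ge0 (hnorm g *: f + (- hnorm f) *: g).
rewrite hdotDr !hdotZr (hdotC _ f) (hdotC _ g) !hdotDr !hdotZr.
rewrite (hdotC g f) -!hnorm_sqr => h.
have : 0 <= (hnorm f * hnorm g) * (hnorm f * hnorm g - hdot f g).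
  by move: h; set A := hnorm f; set B := hnorm g; set D := hdot f g; nra.
by rewrite pmulr_rge0 ?mulr_gt0// subr_ge0.
Qed.

Lemma hnormD (f g : hs) : hnorm (f + g) <= hnorm f + hnorm g.
Proof.
rewrite -(@ler_pXn2r _ 2)// ?nnegrE ?addr_ge0 ?sqrtr_ge0//.
rewrite hnorm_sqr hdotDr (hdotC _ f) (hdotC _ g) !hdotDr (hdotC g f) -!hnorm_sqr.
by have := hdot_le_norm f g; nra.
Qed.

HB.instance Definition _ :=
  @Lmodule_isNormed.Build R hs hnorm hnormD hnormZ hnorm0_eq0.

Lemma hs_coefB (f g : hs) j : (f - g) j = f j - g j.
Proof. by []. Qed.

Lemma hterm_sum_le_norm (f : hs) n : series (hterm f f) n <= `|f| ^+ 2.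
Proof.
rewrite [leRHS]hnorm_sqr; apply: nondecreasing_cvgn_le; last exact: hdot_cvg.
by apply: nondecreasing_series => j _ _; exact: hterm_ge0.
Qed.

Lemma in_hs_bounded (x : nat -> R) (c : R) :
  (forall n, series (hterm x x) n <= c) -> x \in in_hs.
Proof.
move=> xc; apply/asboolP; apply: nondecreasing_is_cvgn.
  by apply: nondecreasing_series => j _ _; exact: hterm_ge0.
by exists c => _ [n _ <-].
Qed.

Lemma hnorm_bounded (f : hs) (c : R) :
  0 <= c -> (forall n, series (hterm f f) n <= c ^+ 2) -> `|f| <= c.
Proof.
move=> c0 fc; rewrite -(@ler_pXn2r _ 2)// ?nnegrE// [leLHS]hnorm_sqr.
by apply: limr_le; [exact: hdot_cvg|near=> n; exact: fc].
Unshelve. all: by end_near. Qed.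

Lemma hs_coef_le (f : hs) j : `|f j| <= Num.sqrt (hweight j)^-1 * `|f|.
Proof.
rewrite -(@ler_pXn2r _ 2)// ?nnegrE// exprMn sqr_sqrtr; last first.
  by rewrite invr_ge0 ltW// hweight_gt0.
rewrite ler_pdivlMl ?hweight_gt0// real_normK ?num_real//.
apply: le_trans (hterm_sum_le_norm f j.+1).
rewrite seriesSr expr2 mulrA -[leLHS]addr0 addrC lerD2r.
by apply: sumr_ge0 => i _; exact: hterm_ge0.
Qed.

Lemma hs_coef_continuous j : continuous (fun f : hs => f j).
Proof.
move=> f; apply/(@cvgrPdist_le _ _ _ (nbhs f)) => e e0.
have wp : 0 < Num.sqrt (hweight j)^-1 by rewrite sqrtr_gt0 invr_gt0 hweight_gt0.
near=> g; rewrite -hs_coefB (le_trans (hs_coef_le _ _))// -ler_pdivlMl//.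
near: g; apply: cvgr_dist_le; first exact: cvg_id.
by rewrite mulr_gt0// invr_gt0.
Unshelve. all: by end_near. Qed.

Fact hs_complete (F : set_system hs) : ProperFilter F -> cauchy F -> cvg F.
Proof.
move=> FF /cauchyP Fex.
have cj j : cvg ((fun f : hs => f j) @ F).
  apply: cauchy_cvg; apply: cauchy_exP => e e0.
  set w := Num.sqrt (hweight j)^-1.
  have wp : 0 < w by rewrite sqrtr_gt0 invr_gt0 hweight_gt0.
  have [|f0 Ff0] := Fex (w^-1 * e); first by rewrite mulr_gt0 ?invr_gt0.
  exists (f0 j); suff : F [set g : hs | ball (f0 j) e (g j)] by [].
  apply: filterS Ff0 => g.
  rewrite -ball_normE/= => fg; rewrite -ball_normE/= -hs_coefB.
  by rewrite (le_lt_trans (hs_coef_le _ _))// -/w -ltr_pdivlMl.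
pose x : nat -> R := fun j => lim ((fun f : hs => f j) @ F).
have bnd e : 0 < e -> exists2 f0 : hs, F (ball f0 e) &
    forall n, series (hterm (x - hs_coef f0) (x - hs_coef f0)) n <= e ^+ 2.
  move=> e0; have [f0 Ff0] := Fex e e0; exists f0 => // n.
  have cs : (fun f : hs => series (hterm (f - f0) (f - f0)) n) @ F -->
      series (hterm (x - hs_coef f0) (x - hs_coef f0)) n.
    rewrite /series/=; elim: n => [|n IHn].
      by under eq_fun do rewrite big_geq//; rewrite big_geq//; exact: cvg_cst.
    under eq_fun do rewrite big_nat_recr//=.
    rewrite big_nat_recr//=; apply: cvgD => //; rewrite /hterm/=.
    have c1 : (fun f : hs => f n - f0 n) @ F --> x n - f0 n.
      by apply: cvgB; [exact: cj|exact: cvg_cst].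
    by apply: cvgM => //; apply: cvgM => //; exact: cvg_cst.
  rewrite -(cvg_lim _ cs)//; apply: limr_le.
    by apply/cvg_ex; eexists; exact: cs.
  apply: filterS Ff0 => g; rewrite -ball_normE/= distrC => /ltW fg.
  apply: le_trans (hterm_sum_le_norm (g - f0) n) _.
  by rewrite lerXn2r// nnegrE// ltW.
have xh : x \in in_hs.
  have [f0 _ /in_hs_bounded xf0] := bnd 1 ltr01.
  by rewrite -[x](subrK (hs_coef f0)) rpredD// hs_coefP.
apply/cvg_ex; exists (Hs xh); apply/cvgrPdist_le => e e0.
have [|f0 Ff0 xf0] := bnd (e / 2); first by rewrite divr_gt0.
apply: filterS Ff0 => g; rewrite -ball_normE/= => /ltW f0g.
rewrite -(subrKA f0) (le_trans (ler_normD _ _))// [leRHS]splitr lerD//.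
by apply: hnorm_bounded => //; rewrite divr_ge0// ltW.
Qed.

HB.instance Definition _ := Uniform_isComplete.Build hs hs_complete.

End weighted_sequences.
Arguments hs R s : clear implicits.

(* Bounded linear maps V -> W with the operator norm. *)
Section bounded_linear_maps.
Context {R : realType} (V W : normedModType R).

Definition in_blin : {pred (V -> W)} :=
  fun f => `[< linear f /\ exists c : R, forall x, `|f x| <= c * `|x| >].

Fact in_blin_submod_closed : submod_closed in_blin.
Proof.
split.
  apply/asboolP; split; first by move=> a x y /=; rewrite scaler0 addr0.
  by exists 0 => x; rewrite normr0 mul0r.
move=> a f g /asboolP[lf [c fc]] /asboolP[lg [d gd]]; apply/asboolP; split.
  move=> b x y; rewrite /= !fctE lf lg !scalerDr !scalerA (mulrC b).
  by rewrite addrACA.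
exists (`|a| * c + d) => x.
rewrite (le_trans (ler_normD _ _))// mulrDl lerD// normrZ -mulrA.
by rewrite ler_wpM2l.
Qed.

HB.instance Definition _ :=
  GRing.isSubmodClosed.Build R (V -> W) in_blin in_blin_submod_closed.

Record blin : Type := Blin { blin_fun :> V -> W ; blin_funP : blin_fun \in in_blin }.

HB.instance Definition _ := [isSub for blin_fun].
HB.instance Definition _ := [Choice of blin by <:].
HB.instance Definition _ := [SubChoice_isSubLmodule of blin by <:].

Definition opnorm (f : V -> W) : R := sup [set `|f x| | x in [set x | `|x| <= 1]].

Lemma blin_lin (f : blin) : linear f.
Proof. by have /asboolP[] := blin_funP f. Qed.

Lemma blinZ (f : blin) a x : f (a *: x) = a *: f x.
Proof.
have l := blin_lin f; have f0 : f 0 = 0.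
  by have := l (-1) 0 0; rewrite scaler0 addr0 scaleN1r addNr.
by rewrite -[a *: x]addr0 l f0 addr0.
Qed.

Lemma opnorm_has_sup (f : blin) :
  has_sup [set `|f x| | x in [set x | `|x| <= 1]].
Proof.
split; first by exists `|f 0|; exists 0 => //=; rewrite normr0.
have /asboolP[_ [c fc]] := blin_funP f; exists `|c| => _ [x /= x1 <-].
rewrite (le_trans (fc x))// (le_trans (ler_wpM2r (normr_ge0 x) (ler_norm c)))//.
by rewrite ler_piMr.
Qed.

Lemma opnorm_ub (f : blin) x : `|f x| <= opnorm f * `|x|.
Proof.
have [->|x0] := eqVneq x 0.
  by rewrite -(scale0r (0 : V)) blinZ !scale0r !normr0 mulr0.
have xp : 0 < `|x| by rewrite normr_gt0.
rewrite -ler_pdivrMr// mulrC -[leLHS](_ : `|f (`|x|^-1 *: x)| = _); last first.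
  by rewrite blinZ normrZ gtr0_norm// invr_gt0.
apply: ub_le_sup; first by have [] := opnorm_has_sup f.
exists (`|x|^-1 *: x) => //=.
by rewrite normrZ gtr0_norm ?invr_gt0// mulVf ?gt_eqF.
Qed.

Lemma opnorm_le (f : blin) c : (forall x, `|x| <= 1 -> `|f x| <= c) ->
  opnorm f <= c.
Proof.
move=> fc; apply: ge_sup; first by have [] := opnorm_has_sup f.
by move=> _ [x /= x1 <-]; exact: fc.
Qed.

Lemma opnorm_ge0 (f : blin) : 0 <= opnorm f.
Proof.
rewrite (le_trans (normr_ge0 (f 0)))//; apply: ub_le_sup.
  by have [] := opnorm_has_sup f.
by exists 0 => //=; rewrite normr0.
Qed.

Lemma opnormD (f g : blin) : opnorm (f + g) <= opnorm f + opnorm g.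
Proof.
apply: (@opnorm_le (f + g)) => x x1 /=.
rewrite (le_trans (ler_normD _ _))// lerD// (le_trans (opnorm_ub _ _))//.
  exact: ler_piMr (opnorm_ge0 f) x1.
exact: ler_piMr (opnorm_ge0 g) x1.
Qed.

Let opnormZ_le a (f : blin) : opnorm (a *: f) <= `|a| * opnorm f.
Proof.
apply: (@opnorm_le (a *: f)) => x x1 /=.
rewrite normrZ ler_wpM2l// (le_trans (opnorm_ub _ _))//.
exact: ler_piMr (opnorm_ge0 f) x1.
Qed.

Lemma opnormZ a (f : blin) : opnorm (a *: f) = `|a| * opnorm f.
Proof.
apply/eqP; rewrite eq_le opnormZ_le/=.
have [->|a0] := eqVneq a 0; first by rewrite normr0 mul0r (opnorm_ge0 (0 *: f)).
rewrite -ler_pdivlMl ?normr_gt0// -normfV.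
have := opnormZ_le a^-1 (a *: f).
rewrite (_ : (a^-1 *: (a *: f) : V -> W) = f)//.
by apply/funext => x /=; rewrite !fctE scalerA mulVf// scale1r.
Qed.

Lemma opnorm0_eq0 (f : blin) : opnorm f = 0 -> f = 0.
Proof.
move=> f0; apply/val_inj/funext => x /=; apply/eqP; rewrite -normr_le0.
by rewrite (le_trans (opnorm_ub f x))// f0 mul0r.
Qed.

HB.instance Definition _ :=
  @Lmodule_isNormed.Build R blin opnorm opnormD opnormZ opnorm0_eq0.

End bounded_linear_maps.

(* The value 0 is used only where f is not differentiable. *)
Definition fderiv {R : realType} {V W : normedModType R} (f : V -> W) (x : V) :
  blin V W := insubd (0 : blin V W) ('d f x : V -> W).

(* Bounded k-linear forms on V, curried: blin V (blin V (... R)). *)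
Fixpoint multilin {R : realType} (V : normedModType R) (k : nat) :
    normedModType R :=
  if k is k'.+1 then blin V (multilin V k') else R^o.

Fixpoint iter_fderiv {R : realType} {V : normedModType R} (f : V -> R)
    (k : nat) : V -> multilin V k :=
  if k is k'.+1 return V -> multilin V k
  then fderiv (iter_fderiv f k') else f.

Definition is_C (n : nat) {R : realType} {V : normedModType R} (f : V -> R) :=
  (forall k, (k < n)%N -> forall x, differentiable (iter_fderiv f k) x) /\
  continuous (iter_fderiv f n).

Section hs_operators.
Context {R : realType}.

(* The element of H^s with coefficients x; the default 0 is taken only if x is
   not in H^s. *)
Definition hs_of (s : R) (x : nat -> R) : hs R s := insubd (0 : hs R s) x.

Definition hs_basis (s : R) (j : nat) : hs R s := hs_of s (fun i => (i == j)%:R).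

(* H^{-l} as the dual of H^l: a functional d is the element of H^{-l} with
   coefficients d phi_j.  By [rieszE] the default value of [hs_of] is never
   reached when d is continuous. *)
Definition riesz (l : R) (d : hs R l -> R) : hs R (- l) :=
  hs_of (- l) (fun j => d (hs_basis l j)).

Lemma hs_ofE s (x : nat -> R) : x \in in_hs s -> hs_of s x = x :> (nat -> R).
Proof. by move=> xh; rewrite /hs_of val_insubd xh. Qed.

Lemma finite_in_hs s (x : nat -> R) n :
  (forall j, (n <= j)%N -> x j = 0) -> x \in in_hs s.
Proof.
move=> x0; apply: (@in_hs_bounded _ s x (series (hterm s x x) n)) => m.
have [mn|/ltnW nm] := leqP m n.
  by apply: nondecreasing_series => // j _ _; exact: hterm_ge0.
rewrite /series/= (big_cat_nat _ nm)//= [X in _ + X]big1_seq ?addr0// => j.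
by rewrite mem_index_iota => /andP[_ /andP[nj _]]; rewrite /hterm x0// mulr0.
Qed.

Lemma hs_basisE s j i : hs_basis s j i = (i == j)%:R.
Proof.
rewrite /hs_basis hs_ofE//; apply: (@finite_in_hs _ _ j.+1) => k jk.
by rewrite gtn_eqF.
Qed.

Lemma hs_basis_sumE s (x : nat -> R) n i :
  (\sum_(j < n) x j *: hs_basis s j) i = if (i < n)%N then x i else 0.
Proof.
elim: n => [|n IHn]; first by rewrite big_ord0.
rewrite big_ord_recr/= [LHS](_ : _ = (\sum_(j < n) x j *: hs_basis s j) i +
  x n * hs_basis s n i)// IHn hs_basisE ltnS.
by case: (ltngtP i n) => [_|_|->] /=; rewrite ?mulr0 ?mulr1 ?addr0 ?add0r.
Qed.

Lemma hs_expansion s (f : hs R s) :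
  (fun n => \sum_(j < n) f j *: hs_basis s j) @ \oo --> f.
Proof.
apply/cvgrPdist_le => e e0; near=> n.
apply: hnorm_bounded; first exact: ltW.
move=> m; set g := f - _.
have gE i : g i = if (i < n)%N then 0 else f i.
  by rewrite /g hs_coefB hs_basis_sumE; case: ifP; rewrite ?subrr ?subr0.
clearbody g; have gS k : (n <= k)%N ->
    series (hterm s g g) k = series (hterm s f f) k - series (hterm s f f) n.
  move=> nk; rewrite /series/= [in RHS](big_cat_nat _ nk)//= [RHS]addrC addKr.
  rewrite (big_cat_nat _ nk)//= big1_seq ?add0r.
    rewrite !big_nat; apply: eq_bigr => j /andP[nj _].
    by rewrite /hterm/= !gE ltnNge nj.
  move=> j; rewrite mem_index_iota => /andP[_ /andP[_ jn]].
  by rewrite /hterm/= !gE jn mulr0.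
apply: (@le_trans _ _ (series (hterm s g g) (maxn m n))).
  by apply: nondecreasing_series; [move=> j _ _; exact: hterm_ge0|exact: leq_maxl].
rewrite gS ?leq_maxr//.
apply: (@le_trans _ _ (hdot f f - series (hterm s f f) n)).
  rewrite lerD2r; apply: nondecreasing_cvgn_le; last exact: hdot_cvg.
  by apply: nondecreasing_series => j _ _; exact: hterm_ge0.
rewrite (le_trans (ler_norm _))//; near: n.
have /cvgrPdist_le := @hdot_cvg _ s f f; apply.
by rewrite exprn_gt0.
Unshelve. all: by end_near. Qed.

Lemma hweightN l j : hweight (- l) j = (hweight l j)^-1 :> R.
Proof. by rewrite /hweight mulrN powRN. Qed.

Lemma rieszE (l : R) (d : {linear hs R l -> R}) j :
  continuous d -> riesz d j = d (hs_basis l j).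
Proof.
move=> /(_ 0)/(@continuous_linear_bounded _ _ _ 0)/linear_boundedP dc.
have [c [c0 {}dc]] : exists c : R, 0 <= c /\ forall x, `|d x| <= c * `|x|.
  near +oo_R => c; exists c; split => //.
  near: c; exact: dc.
rewrite /riesz hs_ofE//; set y := (fun j => _).
apply: (@in_hs_bounded _ _ _ (c ^+ 2)) => n.
set S := series _ n; have S0 : 0 <= S.
  by apply: sumr_ge0 => i _; exact: hterm_ge0.
pose g : hs R l := \sum_(j < n) (hweight (- l) j * y j) *: hs_basis l j.
have dg : d g = S.
  rewrite /g linear_sum/= /S /series/= big_mkord; apply: eq_bigr => i _.
  by rewrite linearZ/=.
have gE i : g i = if (i < n)%N then hweight (- l) i * y i else 0.
  exact: (hs_basis_sumE l (fun j => hweight (- l) j * y j) n i).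
clearbody g; have gS : `|g| <= Num.sqrt S.
  apply: hnorm_bounded; first exact: sqrtr_ge0.
  move=> m; rewrite sqr_sqrtr//.
  apply: (@le_trans _ _ (series (hterm l g g) (maxn m n))).
    by apply: nondecreasing_series; [move=> i _ _; exact: hterm_ge0|exact: leq_maxl].
  rewrite /series/= (big_cat_nat _ (leq_maxr m n))//= [X in _ + X]big1_seq.
    rewrite addr0 /S /series/= le_eqVlt; apply/orP; left; apply/eqP.
    rewrite !big_nat; apply: eq_bigr => i /andP[_ iN].
    rewrite /hterm/= !gE iN hweightN.
    have w0 : hweight l i != 0 :> R by rewrite gt_eqF ?hweight_gt0.
    by field.
  move=> i; rewrite mem_index_iota => /andP[_ /andP[ni _]].
  by rewrite /hterm/= !gE ltnNge ni mulr0.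
have : S <= c * Num.sqrt S.
  by rewrite -{1}dg (le_trans (ler_norm _))// (le_trans (dc _))// ler_wpM2l.
rewrite -{1 3}(sqr_sqrtr S0) => h.
have [->|s0] := eqVneq (Num.sqrt S) 0; first by rewrite expr0n sqr_ge0.
rewrite lerXn2r ?nnegrE ?sqrtr_ge0//.
have sp : 0 < Num.sqrt S by rewrite lt_def s0 sqrtr_ge0.
by rewrite -(ler_pM2r sp) -expr2.
Unshelve. all: by end_near. Qed.

(* The diagonal action of C, whose eigenvalues are lam j ^+ 2; [cov_actE] shows
   that it maps H^{-l} to H^l when j^kappa * lam j is bounded and l <= kappa. *)
Definition cov_act (lam : nat -> R) (s s' : R) (f : hs R s) : hs R s' :=
  hs_of s' (fun j => lam j ^+ 2 * f j).

Lemma cov_actE (lam : nat -> R) (kappa l c : R) (f : hs R (- l)) j :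
  l <= kappa ->
  (forall j, 0 <= lam j) -> (forall j, j.+1%:R `^ kappa * lam j <= c) ->
  cov_act lam l f j = lam j ^+ 2 * f j.
Proof.
move=> lk lam0 lamc; rewrite /cov_act hs_ofE//; set y := (fun j => _).
apply: (@in_hs_bounded _ _ _ (c ^+ 4 * `|f| ^+ 2)) => n.
apply: le_trans (ler_wpM2l _ (hterm_sum_le_norm f n)); last first.
  by rewrite exprn_even_ge0.
rewrite /series/= mulr_sumr; apply: ler_sum => i _.
rewrite /hterm/= /y hweightN.
set w := i.+1%:R `^ l; have w0 : 0 < w by rewrite powR_gt0.
have -> : hweight l i = w ^+ 2 :> R by rewrite /hweight mulrC powRrM powR_mulrn ?powR_ge0.
have wc : 0 <= w * lam i <= c.
  apply/andP; split; first by rewrite mulr_ge0// ltW.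
  apply: le_trans (lamc i); rewrite ler_wpM2r//.
  by rewrite ler_powR// ler1n.
rewrite [leLHS](_ : _ = (w * lam i) ^+ 4 * ((w ^+ 2)^-1 * f i * f i)); last first.
  by field; rewrite gt_eqF.
have /andP[wc0 wcc] := wc.
apply: ler_wpM2r; last by rewrite lerXn2r// nnegrE (le_trans wc0).
by rewrite -mulrA -expr2 mulr_ge0 ?sqr_ge0// invr_ge0 sqr_ge0.
Qed.

(* D Phi : H^l -> H^{-l}. *)
Definition grad (l : R) (Phi : hs R l -> R) (q : hs R l) : hs R (- l) :=
  riesz ('d Phi q).
End hs_operators.

Notation borel V := (g_sigma_algebraType (@open V)).

(* The measure mu P. *)
Section kernel_action.
Local Open Scope ereal_scope.
Context {d : measure_display} {T : measurableType d} {R : realType}.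
Variables (mu : probability T R) (P : R.-pker T ~> T).

Definition kact (A : set T) : \bar R := \int[mu]_x P x A.

Let kact0 : kact set0 = 0.
Proof.
by rewrite /kact (eq_integral (cst 0)) ?integral0// => x _; rewrite measure0.
Qed.

Let kact_ge0 A : 0 <= kact A.
Proof. exact: integral_ge0. Qed.

Let kact_sigma_additive : semi_sigma_additive kact.
Proof.
move=> U mU tU mUU; rewrite [X in _ --> X](_ : _ =
  \int[mu]_x (\sum_(n <oo) P x (U n))); last first.
  apply: eq_integral => V _.
  by apply/esym/cvg_lim => //; exact/measure_semi_sigma_additive.
apply/cvg_closeP; split.
  by apply: is_cvg_nneseries => n _ _; exact: integral_ge0.
by rewrite closeE// integral_nneseries// => n; exact: measurable_kernel.
Qed.

HB.instance Definition _ :=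
  isMeasure.Build _ _ _ kact kact0 kact_ge0 kact_sigma_additive.

Let kact_setT : kact setT = 1.
Proof.
rewrite /kact (eq_integral (cst 1)); last by move=> x _; rewrite prob_kernel.
by rewrite integral_cst//= mul1e; exact: probability_setT.
Qed.

HB.instance Definition _ := Measure_isProbability.Build _ _ _ kact kact_setT.

Definition kact_prob : probability T R := kact.

End kernel_action.

Definition kact_iter {d : measure_display} {T : measurableType d}
    {R : realType} (mu : probability T R) (P : R.-pker T ~> T) (n : nat) :
  probability T R := iter n (fun m => kact_prob m P) mu.

Section wasserstein.
Context {R : realType} {V : normedModType R}.

(* When V is separable the product sigma-algebra on borel V * borel V is the
   Borel sigma-algebra of V * V. *)
Definition coupling (mu nu : probability (borel V) R) :
    set (probability (borel V * borel V)%type R) :=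
  [set g | forall A : set (borel V), measurable A ->
     g (A `*` setT) = mu A /\ g (setT `*` A) = nu A].

Definition W1 (mu nu : probability (borel V) R) : \bar R :=
  ereal_inf [set (\int[g]_z (`|(z.1 : V) - (z.2 : V)|)%:E)%E
            | g in coupling mu nu].

End wasserstein.

Section gaussian.
Context {R : realType} {H : completeNormedModType R}.

(* N(0, v) on the real line; [normal_prob] is not a Dirac mass for v = 0. *)
Definition gauss0 (v : R) : set R -> \bar R :=
  if v == 0 then \d_(0 : R) else normal_prob 0 (Num.sqrt v).

(* pi0 = N(0, C): the law of <u, .> is N(0, <u, C u>) for every u. *)
Definition centred_gaussian (ip : H -> H -> R) (C : H -> H)
    (pi0 : probability (borel H) R) :=
  forall (u : H) (B : set R), measurable B ->
    pi0 [set x | B (ip u x)] = gauss0 (ip u (C u)) B.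

End gaussian.

Section pHMC.
Context {R : realType} {H : completeNormedModType R}.

(* A space with such a basis, indexed by nat, is separable and
   infinite-dimensional. *)
Definition orthonormal_basis (ip : H -> H -> R) (phi : nat -> H) :=
  (forall i j, ip (phi i) (phi j) = (i == j)%:R) /\
  dense [set x | exists n (c : nat -> R), x = \sum_(j < n) c j *: phi j].

(* v seen in H^l; the value is 0 when v is not in H^l. *)
Definition restrict_hs (ip : H -> H -> R) (phi : nat -> H) (l : R) (v : H) :
  hs R l := hs_of l (fun j => ip v (phi j)).

(* C D Phi : H^l -> H^l. *)
Definition cov_grad (lam : nat -> R) (l : R) (Phi : hs R l -> R) (q : hs R l) :
  hs R l := cov_act lam l (grad Phi q).

Definition hamiltonian_flow (lam : nat -> R) (l : R) (Phi : hs R l -> R)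
    (flow : R -> hs R l * hs R l -> hs R l * hs R l) :=
  forall z, flow 0 z = z /\ forall t : R,
    is_derive t 1 (fun u => (flow u z).1) (flow t z).2 /\
    is_derive t 1 (fun u => (flow u z).2)
      (- (flow t z).1 - cov_grad lam Phi (flow t z).1).

(* P(q, .) is the law of the position at time T of the flow started at (q, v)
   with v ~ N(0, C); vectors v outside H^l form a pi0-null set. *)
Definition pHMC_kernel (ip : H -> H -> R) (phi : nat -> H)
    (pi0 : probability (borel H) R) (l : R)
    (flow : R -> hs R l * hs R l -> hs R l * hs R l) (T : R)
    (P : R.-pker borel (hs R l) ~> borel (hs R l)) :=
  forall (q : hs R l) (A : set (borel (hs R l))), measurable A ->
    P q A = pi0 [set v | A (flow T (q, restrict_hs ip phi l v)).1].

End pHMC.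

(* Main.v *)
(** Couple two chains synchronously, giving both the same velocity v at each step.
    The difference z of the two positions then starts with zero velocity and
    solves z'' = - G with |G| <= K |z| and <G, z> >= zeta |z|^2, where K = L + 1.
    As K T^2 <= 1, first |z(t)| <= 2 |z(0)| on [0, T], then
    |z(t) - z(0)| <= K t^2 |z(0)| and |z'(t)| <= (4/3) K t |z(0)|.  Inserting these
    bounds in (|z|^2)'' = 2 |z'|^2 - 2 <G, z> and integrating twice, with
    K^2 T^2 <= zeta, gives |z(T)| <= (1 - zeta T^2 / 27) |z(0)| for every v.
    Integrating over v and over a coupling of the initial laws bounds the transport
    cost after one step. *)

From HB Require Import structures.
Require Import Defs.
From mathcomp Require Import all_boot all_order all_algebra.
From mathcomp Require Import sesquilinear.
From mathcomp Require Import all_classical all_reals all_analysis.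
From mathcomp Require Import measurable_realfun ring lra.

Set Implicit Arguments.
Unset Strict Implicit.
Unset Printing Implicit Defensive.

Import Order.TTheory GRing.Theory Num.Theory.
Import numFieldNormedType.Exports.

Local Open Scope classical_set_scope.
Local Open Scope ring_scope.

(** * Growth of trajectories in H^s *)

Section weighted_inner_product.
Context {R : realType} {s : R}.
Implicit Types (f g : hs R s) (a : R).

Lemma hdotDl f g h : hdot (f + g) h = hdot f h + hdot g h.
Proof. by rewrite hdotC hdotDr !(hdotC h). Qed.

Lemma hdotZl a f g : hdot (a *: f) g = a * hdot f g.
Proof. by rewrite hdotC hdotZr hdotC. Qed.

Lemma hdotBl f g h : hdot (f - g) h = hdot f h - hdot g h.
Proof. by rewrite hdotDl -scaleN1r hdotZl mulN1r. Qed.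

Lemma hdotBr f g h : hdot h (f - g) = hdot h f - hdot h g.
Proof. by rewrite hdotC hdotBl !(hdotC h). Qed.

(** Through this identity the joint continuity of [hdot] reduces to that of the norm. *)
Lemma hdot_polarization f g :
  hdot f g = (`|f + g| ^+ 2 - `|f - g| ^+ 2) / 4.
Proof.
rewrite !(hnorm_sqr (_ : hs R s)) hdotBr !hdotBl hdotDr !hdotDl (hdotC g f).
by field.
Qed.

Lemma cvg_hdot {T : Type} {F : set_system T} {FF : Filter F}
    (x y : T -> hs R s) f g :
  x @ F --> f -> y @ F --> g -> (fun t => hdot (x t) (y t)) @ F --> hdot f g.
Proof.
move=> xf yg; rewrite hdot_polarization.
under eq_fun do rewrite hdot_polarization.
apply: cvgMl; apply: cvgB; rewrite expr2; under eq_fun do rewrite expr2.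
  by apply: cvgM; apply: cvg_norm; apply: cvgD.
by apply: cvgM; apply: cvg_norm; apply: cvgB.
Qed.

Lemma is_derive_hdot (x y : R -> hs R s) (t : R) dx dy :
  is_derive t 1 x dx -> is_derive t 1 y dy ->
  is_derive t 1 (fun u => hdot (x u) (y u)) (hdot dx (y t) + hdot (x t) dy).
Proof.
move=> [dex <-] [dey <-].
(* The difference quotient splits into two terms, in one of which [y] sits at the shifted time; its
   limit uses the continuity of [y] at [t]. *)
have yc : (fun h : R => y (h *: 1 + t)) @ 0^' --> y t.
  have yt : y @ t --> y t.
    by apply: differentiable_continuous; apply/derivable1_diffP.
  apply: (@cvg_comp _ _ _ (fun h : R => h *: 1 + t) y _ (nbhs t) _ _ yt).
  apply: cvg_within_filter.
  have : (fun h : R => h *: (1 : R) + t) @ (0 : R) --> 0 *: (1 : R) + t.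
    by apply: cvgD; [apply: cvgZr_tmp; exact: cvg_id|exact: cvg_cst].
  by rewrite scale0r add0r.
have c : (fun h : R => h^-1 *: (hdot (x (h *: 1 + t)) (y (h *: 1 + t)) -
    hdot (x t) (y t))) @ 0^' --> hdot ('D_1 x t) (y t) + hdot (x t) ('D_1 y t).
  rewrite (_ : (fun h : R => _) = (fun h : R =>
      hdot (h^-1 *: (x (h *: 1 + t) - x t)) (y (h *: 1 + t)) +
      hdot (x t) (h^-1 *: (y (h *: 1 + t) - y t)))).
    by apply: cvgD; apply: cvg_hdot => //; exact: cvg_cst.
  apply/funext => h; rewrite hdotZl hdotZr hdotBl hdotBr /GRing.scale/=; ring.
apply: DeriveDef; first by apply/cvg_ex; eexists; exact: c.
exact: cvg_lim c.
Qed.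

End weighted_inner_product.

(** * Integration of polynomial bounds on a derivative *)

Section cubic_growth.
Context {R : realType}.

(** Subtracting the antiderivative [p] of the bound leaves a function with nonpositive derivative on
    [0, t], to which the mean value theorem applies. Degree 3 is the highest that the estimates
    below produce. *)
Lemma ler_cubic_growth (f df : R -> R) (a b c d t : R) : 0 <= t ->
  (forall u : R, is_derive u 1 f (df u)) ->
  (forall u, 0 <= u <= t -> df u <= a + b * u + c * u ^+ 2 + d * u ^+ 3) ->
  f t - f 0 <= a * t + b * t ^+ 2 / 2 + c * t ^+ 3 / 3 + d * t ^+ 4 / 4.
Proof.
move=> t0 fd fle.
pose p : {poly R} := a *: 'X + (b / 2) *: 'X^2 + (c / 3) *: 'X^3 + (d / 4) *: 'X^4.
have pE u : p.[u] = a * u + b * u ^+ 2 / 2 + c * u ^+ 3 / 3 + d * u ^+ 4 / 4.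
  by rewrite /p !hornerD !hornerZ !hornerXn hornerX; ring.
have dpE u : (deriv p).[u] = a + b * u + c * u ^+ 2 + d * u ^+ 3.
  rewrite /p !derivD !derivZ !derivXn derivX !hornerD !hornerZ !hornerMn !hornerXn.
  by rewrite -polyC1 hornerC; field; rewrite ?pnatr_eq0.
have gd (v : R) : is_derive v 1 (f - horner p) (df v - (deriv p).[v]).
  exact: is_deriveB.
have gc : {within `[0, t], continuous (f - horner p)}.
  apply: derivable_within_continuous => v _.
  exact: (@ex_derive _ _ _ _ _ _ _ (gd v)).
have [v vt] := MVT_segment t0 (fun v _ => gd v) gc.
rewrite !fctE => E.
have : f t - p.[t] - (f 0 - p.[0]) <= 0.
  have vt' : 0 <= v <= t by move: vt; rewrite in_itv.
  have := fle v vt'; rewrite -dpE -subr_le0 => dv.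
  by rewrite E subr0; apply: mulr_le0_ge0.
rewrite !pE !expr0n/=; lra.
Qed.

(** The scalar bound is applied to the component of [f] along its own increment [e]; Cauchy-Schwarz
    bounds the derivative, and a factor [|e|] cancels. *)
Lemma ler_norm_cubic_growth (s : R) (f df : R -> hs R s) (a b c d t : R) :
  0 <= t -> (forall u : R, is_derive u 1 f (df u)) ->
  (forall u, 0 <= u <= t -> `|df u| <= a + b * u + c * u ^+ 2 + d * u ^+ 3) ->
  `|f t - f 0| <= a * t + b * t ^+ 2 / 2 + c * t ^+ 3 / 3 + d * t ^+ 4 / 4.
Proof.
move=> t0 fd fle; set e := f t - f 0.
have [->|ne0] := eqVneq e 0.
  (* The right-hand side is nonnegative because it bounds the growth of the zero function. *)
  rewrite normr0 -[leLHS](subrr (0 : R)).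
  apply: (@ler_cubic_growth (cst 0) (cst 0)) => // u /fle ule.
  exact: (le_trans (normr_ge0 _) ule).
have n0 : 0 < `|e| by rewrite normr_gt0.
have ed (u : R) : is_derive u 1 (fun v => hdot (f v) e) (hdot (df u) e).
  have := @is_derive_hdot R s f (cst e) u (df u) 0 (fd u) (is_derive_cst _ _ _).
  by rewrite -(scale0r (0 : hs R s)) hdotZr mul0r addr0.
have := @ler_cubic_growth _ _ (a * `|e|) (b * `|e|) (c * `|e|) (d * `|e|) t t0 ed.
rewrite -hdotBl -/e -(hnorm_sqr e) => h.
rewrite -(ler_pM2r n0) -expr2.
apply: (le_trans (h _)); last by lra.
move=> u /fle ule; apply: (le_trans (hdot_le_norm _ _)).
rewrite (_ : _ + _ = (a + b * u + c * u ^+ 2 + d * u ^+ 3) * `|e|); last by ring.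
by rewrite ler_pM2r.
Qed.

End cubic_growth.

(* [z] and [w] are the differences of the positions and of the velocities of two
   solutions, and [G] that of the forces, whose monotonicity and Lipschitz
   constants are [zeta] and [K]. *)
Section difference_of_trajectories.
Context {R : realType} {s : R}.
Variables (z w G : R -> hs R s) (K T : R).
Hypothesis zd : forall t : R, is_derive t 1 z (w t).
Hypothesis wd : forall t : R, is_derive t 1 w (- G t).
Hypothesis K0 : 0 <= K.
Hypothesis T0 : 0 <= T.
Hypothesis KT1 : K * T ^+ 2 <= 1.
Hypothesis G_le : forall t, `|G t| <= K * `|z t|.

(** The form p + q u^2 serves both the constant bound of [position_le] and the sharper bound that
    [position_dist_le] yields. *)
Lemma velocity_growth (p q t : R) : 0 <= t ->
  (forall u, 0 <= u <= t -> `|z u| <= p + q * u ^+ 2) ->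
  `|w t - w 0| <= K * (p * t + q * t ^+ 3 / 3).
Proof.
move=> t0 zle.
have := @ler_norm_cubic_growth R s w (fun u => - G u) (K * p) 0 (K * q) 0 t t0 wd.
rewrite (_ : K * (p * t + q * t ^+ 3 / 3) = K * p * t + 0 * t ^+ 2 / 2 +
  K * q * t ^+ 3 / 3 + 0 * t ^+ 4 / 4); last by ring.
move=> h; apply: h => u /zle ule; rewrite normrN (le_trans (G_le u))//.
have := ler_wpM2l K0 ule; lra.
Qed.

Lemma position_growth (a b t : R) : 0 <= t ->
  (forall u, 0 <= u <= t -> `|w u| <= a + b * u) ->
  `|z t - z 0| <= a * t + b * t ^+ 2 / 2.
Proof.
move=> t0 wle.
have := @ler_norm_cubic_growth R s z w a b 0 0 t t0 zd => h.
rewrite (_ : a * t + b * t ^+ 2 / 2 = a * t + b * t ^+ 2 / 2 +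
  0 * t ^+ 3 / 3 + 0 * t ^+ 4 / 4); last by ring.
apply: h => u /wle ule; lra.
Qed.

(** Let c maximize |z| on [0, T]. Up to time c the force is at most K |z c|, so two integrations
    give |z c| <= |z 0| + T |w 0| + K |z c| c^2 / 2. As K c^2 <= 1, the last term is at most |z c| /
    2 and is absorbed on the left, whence the factor 2. *)
Lemma position_le t : 0 <= t <= T -> `|z t| <= 2 * (`|z 0| + T * `|w 0|).
Proof.
move=> tT.
have zc : {within `[0, T], continuous (fun u => `|z u|)}.
  apply: continuous_subspaceT => u; apply: cvg_norm.
  have : differentiable z u.
    by apply/derivable1_diffP; exact: (@ex_derive _ _ _ _ _ _ _ (zd u)).
  by move/differentiable_continuous.
have [c] := EVT_max T0 zc; rewrite in_itv/= => /andP[c0 cT] zm.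
have {}zm u : 0 <= u <= T -> `|z u| <= `|z c| by move=> uT; apply: zm; rewrite in_itv.
suff zc_le : `|z c| <= 2 * (`|z 0| + T * `|w 0|) by rewrite (le_trans (zm t tT)).
have wc u : 0 <= u <= c -> `|w u| <= `|w 0| + (K * `|z c|) * u.
  move=> /andP[u0 uc].
  rewrite -[w u](subrK (w 0)) (le_trans (ler_normD _ _))// addrC lerD2l.
  have := @velocity_growth `|z c| 0 u u0.
  rewrite mul0r mul0r addr0 mulrA => h; apply: h => v /andP[v0 vu].
  by rewrite mul0r addr0 zm// v0 (le_trans vu)// (le_trans uc).
have := position_growth c0 wc.
have : `|z c| <= `|z c - z 0| + `|z 0| by rewrite -{1}[z c](subrK (z 0)) ler_normD.
have : K * `|z c| * c ^+ 2 <= `|z c|.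
  rewrite mulrAC ler_piMl// (le_trans _ KT1)// ler_wpM2l//.
  by rewrite lerXn2r ?nnegrE// (le_trans c0).
have : `|w 0| * c <= T * `|w 0| by rewrite mulrC ler_wpM2r.
by set A := `|_|; set B := `|_|; set D := `|_|; set E := K * _ * _ ; lra.
Qed.

Hypothesis w0 : w 0 = 0.
Variable zeta : R.
Hypothesis zeta0 : 0 <= zeta.
Hypothesis G_ge : forall t, zeta * `|z t| ^+ 2 <= hdot (G t) (z t).

Lemma position_dist_le t : 0 <= t <= T -> `|z t - z 0| <= K * `|z 0| * t ^+ 2.
Proof.
move=> /andP[t0 tT].
have := @position_growth 0 (K * (2 * `|z 0|)) t t0.
rewrite mul0r add0r (_ : _ / 2 = K * `|z 0| * t ^+ 2); last by field.
move=> h; apply: h => u /andP[u0 ut].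
have := @velocity_growth (2 * `|z 0|) 0 u u0.
rewrite w0 subr0 !mul0r addr0 add0r mulrA => h'; apply: h' => v /andP[v0 vu].
rewrite mul0r addr0; have := @position_le v; rewrite w0 normr0 mulr0 addr0; apply.
by rewrite v0 (le_trans vu)// (le_trans ut).
Qed.

Lemma sqr_le_of_time t : 0 <= t <= T -> K * t ^+ 2 <= 1.
Proof.
move=> /andP[t0 tT]; rewrite (le_trans _ KT1)// ler_wpM2l//.
by rewrite lerXn2r ?nnegrE.
Qed.

Lemma velocity_le t : 0 <= t <= T -> `|w t| <= 4 / 3 * K * `|z 0| * t.
Proof.
move=> tT; have /andP[t0 _] := tT.
have := @velocity_growth `|z 0| (K * `|z 0|) t t0; rewrite w0 subr0 => h.
have {}h : `|w t| <= K * (`|z 0| * t + K * `|z 0| * t ^+ 3 / 3).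
  apply: h => u /andP[u0 ut].
  rewrite -{1}[z u](subrK (z 0)) (le_trans (ler_normD _ _))// addrC lerD2l.
  by apply: position_dist_le; rewrite u0 (le_trans ut)//; case/andP: tT.
(* Since K t^2 <= 1, the cubic term is at most a third of the linear one: 4/3 = 1 + 1/3. *)
apply: (le_trans h).
have : (K * `|z 0| * t) * (K * t ^+ 2) <= (K * `|z 0| * t) * 1.
  by rewrite ler_wpM2l ?sqr_le_of_time// !mulr_ge0.
set A := `|_|; lra.
Qed.

(** With E = K t^2 <= 1, the triangle inequality gives |z t| >= |z 0| (1 - E), where both sides are
    nonnegative; squaring and dropping E^2 gives the claim. It turns the monotonicity of [G] into a
    bound by the initial distance. *)
Lemma position_sqr_ge t : 0 <= t <= T ->
  `|z 0| ^+ 2 * (1 - 2 * K * t ^+ 2) <= `|z t| ^+ 2.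
Proof.
move=> tT; have dle := position_dist_le tT; have kt := sqr_le_of_time tT.
have kt0 : 0 <= K * t ^+ 2 by rewrite mulr_ge0 ?sqr_ge0.
have : `|z 0| <= `|z t - z 0| + `|z t|.
  by rewrite distrC -{1}[z 0](subrK (z t)) ler_normD.
move: dle (normr_ge0 (z t)) (normr_ge0 (z 0)).
set A := `|z 0|; set B := `|z t|; set D := `|_|; set E := K * t ^+ 2 in kt kt0 *.
rewrite (_ : K * A * t ^+ 2 = A * E); last by rewrite /E; ring.
rewrite (_ : 2 * K * t ^+ 2 = 2 * E); last by rewrite /E; ring.
move=> dle B0 A0 tri.
have AB : A * (1 - E) <= B by lra.
have : (A * (1 - E)) ^+ 2 <= B ^+ 2.
  by rewrite lerXn2r ?nnegrE// mulr_ge0// subr_ge0.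
have : 0 <= A ^+ 2 * E ^+ 2 by rewrite mulr_ge0 ?sqr_ge0.
lra.
Qed.

(** The derivative of <z, w> is |w|^2 - <z, G>. [velocity_le] bounds the first term, giving 16/9
    K^2, and [G_ge] with [position_sqr_ge] the second; <z, w> starts at 0. *)
Lemma dot_velocity_le t : 0 <= t <= T ->
  hdot (z t) (w t) <= `|z 0| ^+ 2 *
    (- zeta * t + (16 / 9 * K ^+ 2 + 2 * zeta * K) * t ^+ 3 / 3).
Proof.
move=> tT; have /andP[t0 tT'] := tT; set A := `|z 0|.
have zwd (u : R) : is_derive u 1 (fun v => hdot (z v) (w v))
    (hdot (w u) (w u) + hdot (z u) (- G u)) by exact: is_derive_hdot.
have := @ler_cubic_growth _ _ _ (A ^+ 2 * - zeta) 0
  (A ^+ 2 * (16 / 9 * K ^+ 2 + 2 * zeta * K)) 0 t t0 zwd.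
rewrite w0 (_ : hdot (z 0) 0 = 0); last by rewrite -(scale0r (0 : hs R s)) hdotZr mul0r.
rewrite subr0 => h; apply: (le_trans (h _)); last by lra.
move=> u /andP[u0 ut]; have uT : 0 <= u <= T by rewrite u0 (le_trans ut).
rewrite -(hnorm_sqr (w u)) -scaleN1r hdotZr mulN1r hdotC.
have : `|w u| ^+ 2 <= (4 / 3 * K * A * u) ^+ 2.
  by rewrite lerXn2r ?nnegrE ?velocity_le// (le_trans _ (velocity_le uT)).
have := G_ge u.
have := ler_wpM2l zeta0 (position_sqr_ge uT); rewrite -/A.
rewrite -[hnorm (w u)]/`|w u|; set B := `|z u|; set D := `|w u|; lra.
Qed.

Lemma position_contraction : K ^+ 2 * T ^+ 2 <= zeta -> zeta * T ^+ 2 <= 1 ->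
  `|z T| <= (1 - 1 / 27 * zeta * T ^+ 2) * `|z 0|.
Proof.
move=> KTz zT1; set A := `|z 0|.
have zzd (u : R) : is_derive u 1 (fun v => hdot (z v) (z v))
    (hdot (w u) (z u) + hdot (z u) (w u)) by exact: is_derive_hdot.
have := @ler_cubic_growth _ _ _ 0 (A ^+ 2 * (- 2 * zeta)) 0
  (A ^+ 2 * 2 / 3 * (16 / 9 * K ^+ 2 + 2 * zeta * K)) T T0 zzd.
rewrite -!hnorm_sqr -[hnorm (z T)]/`|z T| -[hnorm (z 0)]/A => h.
have {}h : `|z T| ^+ 2 - A ^+ 2 <= A ^+ 2 * (- zeta * T ^+ 2 +
    (16 / 9 * K ^+ 2 + 2 * zeta * K) * T ^+ 4 / 6).
  apply: (le_trans (h _)); last by lra.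
  move=> u uT; rewrite hdotC; have := dot_velocity_le uT; rewrite -/A; lra.
have x0 : 0 <= zeta * T ^+ 2 by rewrite mulr_ge0 ?sqr_ge0.
rewrite -(@ler_pXn2r _ 2)// ?nnegrE//; last by rewrite mulr_ge0 ?normr_ge0//; lra.
rewrite exprMn -/A.
(* With x = zeta T^2, the positive terms are at most 8/27 x by K^2 T^2 <= zeta and 9/27 x by K T^2
   <= 1, which leaves -10/27 x. The weaker -2/27 x suffices, as (1 - x/27)^2 >= 1 - 2x/27. *)
have c : - zeta * T ^+ 2 + (16 / 9 * K ^+ 2 + 2 * zeta * K) * T ^+ 4 / 6 <=
    - (2 / 27) * (zeta * T ^+ 2).
  have : (K ^+ 2 * T ^+ 2) * T ^+ 2 <= zeta * T ^+ 2 by rewrite ler_wpM2r ?sqr_ge0.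
  have : (zeta * T ^+ 2) * (K * T ^+ 2) <= (zeta * T ^+ 2) * 1 by rewrite ler_wpM2l.
  lra.
have := ler_wpM2l (sqr_ge0 A) c.
have : 0 <= A ^+ 2 * (zeta * T ^+ 2) ^+ 2 by rewrite mulr_ge0 ?sqr_ge0.
lra.
Qed.

End difference_of_trajectories.

(** * Differences of two solutions of the Hamiltonian flow *)

Section flow_contraction.
Context {R : realType} {l : R}.
Variables (lam : nat -> R) (L zeta T : R) (Phi : hs R l -> R)
  (flow : R -> hs R l * hs R l -> hs R l * hs R l).
Hypothesis flowP : hamiltonian_flow lam Phi flow.
Hypothesis L0 : 0 < L.
Hypothesis T0 : 0 < T.
Hypothesis LT1 : (L + 1) * T ^+ 2 <= 1.
Hypothesis cov_grad_lip : forall q q',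
  `|cov_grad lam Phi q - cov_grad lam Phi q'| <= L * `|q - q'|.

Let z (a b : hs R l * hs R l) t := (flow t a).1 - (flow t b).1.
Let w (a b : hs R l * hs R l) t := (flow t a).2 - (flow t b).2.
(** The force is q + C D Phi(q), so the identity part adds 1 to the Lipschitz constant [L], and (A2)
    is exactly the monotonicity of this difference. *)
Let G (a b : hs R l * hs R l) t := z a b t +
  (cov_grad lam Phi (flow t a).1 - cov_grad lam Phi (flow t b).1).

Let zd a b (t : R) : is_derive t 1 (z a b) (w a b t).
Proof.
have [_ /(_ t)[da _]] := flowP a; have [_ /(_ t)[db _]] := flowP b.
exact: (is_deriveB da db).
Qed.

Let wd a b (t : R) : is_derive t 1 (w a b) (- G a b t).
Proof.
have [_ /(_ t)[_ da]] := flowP a; have [_ /(_ t)[_ db]] := flowP b.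
rewrite [X in is_derive _ _ _ X](_ : _ =
  (- (flow t a).1 - cov_grad lam Phi (flow t a).1) -
  (- (flow t b).1 - cov_grad lam Phi (flow t b).1)).
  exact: (is_deriveB da db).
by rewrite /G /z !opprD !opprK addrACA.
Qed.

Let z0 a b : z a b 0 = a.1 - b.1.
Proof. by rewrite /z; have [-> _] := flowP a; have [-> _] := flowP b. Qed.

Let w0 a b : w a b 0 = a.2 - b.2.
Proof. by rewrite /w; have [-> _] := flowP a; have [-> _] := flowP b. Qed.

Let G_le a b t : `|G a b t| <= (L + 1) * `|z a b t|.
Proof.
rewrite (le_trans (ler_normD _ _))// mulrDl mul1r addrC lerD2r.
exact: cov_grad_lip.
Qed.

Let K0 : 0 <= L + 1. Proof. by rewrite addr_ge0// ltW. Qed.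

(** Here the initial velocities may differ: the bound gives joint continuity in position and
    velocity, hence measurability of the position update. *)
Lemma flow_lipschitz a b : `|(flow T a).1 - (flow T b).1| <=
  2 * (`|a.1 - b.1| + T * `|a.2 - b.2|).
Proof.
have := @position_le R l (z a b) (w a b) (G a b) _ _ (zd a b) (wd a b) K0 (ltW T0)
  LT1 (G_le a b) T; rewrite z0 w0; apply.
by rewrite lexx ltW.
Qed.

Lemma flow_position_continuous : continuous (fun a => (flow T a).1).
Proof.
move=> a; apply/cvgrPdist_le => e e0; near=> b.
apply: (le_trans (flow_lipschitz a b)).
have d1 : `|a.1 - b.1| <= e / 4.
  near: b; apply: cvgr_dist_le; last by rewrite divr_gt0.
  exact: cvg_fst.
have d2 : T * `|a.2 - b.2| <= e / 4.
  rewrite -ler_pdivlMl//; near: b; apply: cvgr_dist_le.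
    exact: cvg_snd.
  by rewrite mulr_gt0 ?invr_gt0// divr_gt0.
lra.
Unshelve. all: by end_near. Qed.

Hypothesis zeta0 : 0 < zeta.
Hypothesis cov_grad_mono : forall x y : hs R l, zeta * `|x - y| ^+ 2 <=
  hdot (x - y) (x - y) +
  hdot (cov_grad lam Phi x - cov_grad lam Phi y) (x - y).

Lemma flow_contraction q q' v : (L + 1) ^+ 2 * T ^+ 2 <= zeta ->
  zeta * T ^+ 2 <= 1 ->
  `|(flow T (q, v)).1 - (flow T (q', v)).1| <=
    (1 - 1 / 27 * zeta * T ^+ 2) * `|q - q'|.
Proof.
move=> KTz zT1; pose a := (q, v); pose b := (q', v).
have w00 : w a b 0 = 0 by rewrite w0 subrr.
have := @position_contraction R l (z a b) (w a b) (G a b) _ _ (zd a b) (wd a b) K0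
  (ltW T0) LT1 (G_le a b) w00 zeta (ltW zeta0); rewrite z0 => h; apply: h => //.
by move=> t; rewrite /G hdotDl; exact: cov_grad_mono.
Qed.

End flow_contraction.

(** * Borel measurability in separable spaces *)

Section countable_dense_measurability.
Context {R : realType} {d : measure_display} {Omega : measurableType d}.

(** The balls around the [e n] with radii 1/(k+1) form a countable base, so [U] is the countable
    union of those it contains. *)
Lemma preimage_open_measurable {X : pseudoMetricType R} (e : nat -> X)
    (h : Omega -> X) :
  (forall x (r : R), 0 < r -> exists n, ball (e n) r x) ->
  (forall n (r : R), measurable (h @^-1` ball (e n) r)) ->
  forall U : set X, open U -> measurable (h @^-1` U).
Proof.
move=> dense_e mball U oU.
pose B (p : nat * nat) : set X := ball (e p.1) p.2.+1%:R^-1.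
have -> : h @^-1` U = \bigcup_(p in [set p | B p `<=` U]) h @^-1` B p.
  apply/seteqP; split=> [x Ux|x [p pU /pU]//].
  have /nbhs_ballP[r /= r0 rU] : nbhs (h x) U by exact: open_nbhs_nbhs.
  (* Radius below r/2, because two steps through the centre [e n] must stay within r. *)
  have [k kr] : exists k : nat, k.+1%:R^-1 < r / 2.
    have r20 : 0 < r / 2 by rewrite divr_gt0.
    near \oo => k; exists k; near: k.
    exact: (near_infty_natSinv_lt (PosNum r20)).
  have k0 : 0 < k.+1%:R^-1 :> R by rewrite invr_gt0.
  have [n nx] := dense_e (h x) _ k0.
  exists (n, k) => //= y ny; apply: rU; rewrite (splitr r).
  apply: (@ball_triangle _ _ (e n)).
    by apply: (le_ball (ltW kr)); exact: ball_sym.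
  exact: (le_ball (ltW kr)).
rewrite bigcup_mkcond; apply: countable_bigcupT_measurable => // p.
case: ifPn => // _; exact: mball.
Unshelve. all: by end_near. Qed.

End countable_dense_measurability.

Section dense_sequences.
Context {R : realType}.

Definition dense_seq {X : pseudoMetricType R} (e : nat -> X) :=
  forall x (r : R), 0 < r -> exists n, ball (e n) r x.

(** [n] is read as the code of a pair of indices; the default covers numbers that code no pair,
    while density uses codes only. *)
Definition pair_seq {X Y : Type} (e : nat -> X) (e' : nat -> Y) (n : nat) : X * Y :=
  let p := odflt (0, 0)%N (unpickle n) in (e p.1, e' p.2).

Lemma dense_pair_seq {X Y : pseudoMetricType R} (e : nat -> X) (e' : nat -> Y) :
  dense_seq e -> dense_seq e' -> dense_seq (pair_seq e e').
Proof.
move=> de de' [x y] r r0; have [n nx] := de x r r0; have [m my] := de' y r r0.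
by exists (pickle (n, m)); rewrite /pair_seq pickleK.
Qed.

Definition hs_rational (s : R) (c : seq rat) : hs R s :=
  \sum_(j < size c) ratr c`_j *: hs_basis s j.

Definition hs_seq (s : R) (n : nat) : hs R s :=
  hs_rational s (odflt [::] (unpickle n)).

(** Half of r pays for truncating the expansion after n terms, the other half for rational
    approximation, at most r/2/(n+1) per term. *)
Lemma dense_hs_seq (s : R) : dense_seq (hs_seq s).
Proof.
move=> f r r0; have r20 : 0 < r / 2 by rewrite divr_gt0.
have [n fn] : exists n : nat, `|f - \sum_(j < n) f j *: hs_basis s j| < r / 2.
  have /cvgrPdist_lt /(_ _ r20)[N _ fN] := @hs_expansion R s f.
  by exists N; apply: fN => /=.
have approx j : exists q : rat,
    `|f j - ratr q| * (`|hs_basis s j| * n.+1%:R) < r / 2.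
  (* The added 1 keeps the divisor positive without knowing that the basis vector is nonzero. *)
  have den0 : 0 < `|hs_basis s j| * n.+1%:R + 1 by rewrite ltr_wpDl.
  have e0 : 0 < r / 2 / (`|hs_basis s j| * n.+1%:R + 1) by rewrite divr_gt0.
  have /rat_in_itvoo[q] : f j < f j + r / 2 / (`|hs_basis s j| * n.+1%:R + 1).
    by rewrite ltrDl.
  rewrite in_itv/= => /andP[fq qf]; exists q.
  have : `|f j - ratr q| < r / 2 / (`|hs_basis s j| * n.+1%:R + 1).
    rewrite distrC gtr0_norm ?subr_gt0//; lra.
  rewrite ltr_pdivlMr// => h; apply: le_lt_trans h.
  by rewrite ler_wpM2l// lerDl.
have [q qP] := choice approx.
exists (pickle (mkseq q n)); rewrite /hs_seq pickleK/= /hs_rational size_mkseq.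
rewrite -ball_normE/= distrC -(subrKA (\sum_(j < n) f j *: hs_basis s j)).
rewrite (le_lt_trans (ler_normD _ _))// (splitr r) ltr_leD//.
rewrite -sumrB (le_trans (ler_norm_sum _ _ _))//.
rewrite (@le_trans _ _ (\sum_(j < n) r / 2 / n.+1%:R))//.
  apply: ler_sum => j _; rewrite nth_mkseq// -scalerBl normrZ.
  by rewrite ler_pdivlMr// -mulrA ltW.
rewrite sumr_const card_ord -[leLHS]mulr_natr -[leLHS]mulrA ler_piMr ?(ltW r20)//.
by rewrite mulrC ler_pdivrMr// mul1r ler_nat.
Qed.

End dense_sequences.

Section borel_measurability.
Context {R : realType} {d : measure_display} {Omega : measurableType d}.

Lemma measurable_borel {V : normedModType R} (f : Omega -> V) :
  (forall U : set V, open U -> measurable (f @^-1` U)) ->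
  measurable_fun setT (f : Omega -> borel V).
Proof.
move=> fU; apply: (@measurability _ _ Omega (borel V) setT f (@open V)) => //.
by move=> _ [U oU <-]; rewrite setTI; exact: fU.
Qed.

Lemma measurable_preimage_open {V : normedModType R} (f : Omega -> borel V)
    (U : set V) : measurable_fun setT f -> open U -> measurable (f @^-1` U).
Proof.
move=> mf oU; rewrite -[f @^-1` U]setTI; apply: mf => //.
exact: sub_sigma_algebra.
Qed.

Lemma measurable_borel_real (f : Omega -> R) :
  (forall U : set R, open U -> measurable (f @^-1` U)) -> measurable_fun setT f.
Proof.
move=> fU; apply: (measurability _ (RGenOInfty.measurableE R)).
move=> _ [_ [x ->] <-]; rewrite setTI; apply: fU.
exact: interval_open.
Qed.

(** By separability it suffices to treat balls, and the squared distance to a centre is a pointwise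
    limit of finite sums in the coordinates. *)
Lemma measurable_hs (s : R) (f : Omega -> hs R s) :
  (forall j, measurable_fun setT (fun x => f x j)) ->
  measurable_fun setT (f : Omega -> borel (hs R s)).
Proof.
move=> mf; apply: measurable_borel.
apply: (preimage_open_measurable (@dense_hs_seq R s)) => n r.
set c := hs_seq s n.
have mdot : measurable_fun setT (fun x => hdot (c - f x) (c - f x)).
  apply: (@measurable_fun_cvg _ _ _ _
    (fun n x => series (hterm s (c - f x) (c - f x)) n)).
    move=> m; rewrite /series/=; apply: measurable_sum => i.
    have mc : measurable_fun setT (fun x => c i - f x i).
      exact: measurable_funB.
    by apply: measurable_funM => //; apply: measurable_funM.
  by move=> x _; exact: hdot_cvg.
have mnorm : measurable_fun setT (fun x => `|c - f x|).
  have msqrt : measurable_fun setT (@Num.sqrt R).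
    by apply: continuous_measurable_fun; exact: sqrt_continuous.
  exact: (measurableT_comp msqrt mdot).
rewrite (_ : _ @^-1` _ = (fun x => `|c - f x|) @^-1` `]-oo, r[%classic).
  by rewrite -[_ @^-1` _]setTI; exact: mnorm.
by apply/seteqP; split=> x; rewrite -ball_normE/= in_itv.
Qed.

(** By separability an open subset of [V * W] is a countable union of products of balls, so
    measurability of each component is enough. *)
Lemma measurable_continuous_pair {V W X : normedModType R}
    (e : nat -> V) (e' : nat -> W) (F : V * W -> X)
    (f : Omega -> V) (g : Omega -> W) :
  dense_seq e -> dense_seq e' -> continuous F ->
  measurable_fun setT (f : Omega -> borel V) ->
  measurable_fun setT (g : Omega -> borel W) ->
  forall U : set X, open U -> measurable ((fun x => F (f x, g x)) @^-1` U).
Proof.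
move=> de de' cF mf mg U oU.
have oFU : open (F @^-1` U) by apply: open_comp => // x _; exact: cF.
apply: (preimage_open_measurable (dense_pair_seq de de') _ oFU) => n r.
rewrite (_ : _ @^-1` _ = f @^-1` ball (pair_seq e e' n).1 r `&`
    g @^-1` ball (pair_seq e e' n).2 r) //.
have [r0|r0] := leP r 0.
  rewrite (_ : _ `&` _ = set0)//; apply/seteqP; split=> // x [].
  by rewrite -ball_normE/= => /(le_lt_trans (normr_ge0 _)); rewrite ltNge r0.
by apply: measurableI; apply: measurable_preimage_open => //; exact: ball_open.
Qed.

End borel_measurability.

(** * Synchronous coupling *)

Section product_probability.
Context {d1 d2 : measure_display} {T1 : measurableType d1}
  {T2 : measurableType d2} {R : realType}.
Variables (m1 : probability T1 R) (m2 : probability T2 R).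

Definition product_probability : set (T1 * T2) -> \bar R := (m1 \x m2)%E.

HB.instance Definition _ := Measure.on product_probability.

Let product_probability_setT : (product_probability setT = 1)%E.
Proof.
rewrite -setXTT /product_probability product_measure1E//.
by rewrite -[RHS]mule1; congr (_ * _)%E; exact: probability_setT.
Qed.

HB.instance Definition _ :=
  Measure_isProbability.Build _ _ _ product_probability product_probability_setT.

End product_probability.

Section random_map.
Local Open Scope ereal_scope.
Context {R : realType} {V : normedModType R} {d : measure_display}
  {Y : measurableType d}.
Variables (rho : probability Y R) (F : borel V * Y -> borel V)
  (P : R.-pker borel V ~> borel V).
Hypothesis mF : measurable_fun setT F.
Hypothesis FP : forall x A, measurable A -> P x A = rho [set y | A (F (x, y))].

Section coupled.
Variable g : probability (borel V * borel V)%type R.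

Let Psi (z : borel V * borel V * Y) : borel V * borel V :=
  (F (z.1.1, z.2), F (z.1.2, z.2)).

Let mz1 : measurable_fun setT (fun z : borel V * borel V * Y => (z.1.1, z.2)).
Proof.
apply: measurable_fun_pair; last exact: measurable_snd.
exact: measurableT_comp measurable_fst measurable_fst.
Qed.

Let mz2 : measurable_fun setT (fun z : borel V * borel V * Y => (z.1.2, z.2)).
Proof.
apply: measurable_fun_pair; last exact: measurable_snd.
exact: measurableT_comp measurable_snd measurable_fst.
Qed.

Let mPsi : measurable_fun setT Psi.
Proof. by apply: measurable_fun_pair; exact: measurableT_comp. Qed.

HB.instance Definition _ := isMeasurableFun.Build _ _ _ _ Psi mPsi.

Definition synchronous_coupling : probability (borel V * borel V)%type R :=
  distribution (product_probability g rho) Psi.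

Let integral_kernel_image (m : probability (borel V) R)
    (p : borel V * borel V -> borel V) A : measurable A ->
  measurable_fun setT p ->
  (forall B, measurable B -> g (p @^-1` B) = m B) ->
  \int[g]_z P (p z) A = \int[m]_x P x A.
Proof.
move=> mA mp gm.
rewrite -[LHS](@ge0_integral_pushforward _ _ _ _ _ _ mp g setT (P ^~ A))//.
  by apply: eq_measure_integral => B mB _; exact: gm.
exact: measurable_kernel.
Qed.

(** The product measure of a preimage integrates, over [g], the [rho]-mass of its sections. By [FP]
    that mass is the kernel at one coordinate of the pair, whose law is a marginal of [g]. *)
Lemma synchronous_coupling_coupling (mu nu : probability (borel V) R) :
  coupling mu nu g ->
  coupling (kact_prob mu P) (kact_prob nu P) synchronous_coupling.
Proof.
move=> gmn A mA; split.
  transitivity (\int[g]_z P (fst z) A).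
    apply: eq_integral => z _; rewrite FP//=; congr (rho _).
    by apply/seteqP; split=> y /=; rewrite /xsection/= inE/=; [case|split].
  apply: (@integral_kernel_image mu fst A mA measurable_fst).
  move=> B mB; have [<- _] := gmn B mB; congr (g _).
  by apply/seteqP; split=> [z Bz|z []].
transitivity (\int[g]_z P (snd z) A).
  apply: eq_integral => z _; rewrite FP//=; congr (rho _).
  by apply/seteqP; split=> y /=; rewrite /xsection/= inE/=; [case|split].
apply: (@integral_kernel_image nu snd A mA measurable_snd).
move=> B mB; have [_ <-] := gmn B mB; congr (g _).
by apply/seteqP; split=> [z Bz|z []].
Qed.

Variable k : R.
Hypothesis k0 : (0 < k)%R.
Hypothesis F_contract : forall (x x' : V) y,
  (`|(F (x, y) : V) - (F (x', y) : V)| <= k * `|x - x'|)%R.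
Hypothesis mdist : measurable_fun setT
  (fun z : borel V * borel V => `|(z.1 : V) - (z.2 : V)|%R).

Lemma synchronous_coupling_cost :
  \int[synchronous_coupling]_z (`|(z.1 : V) - (z.2 : V)|)%:E <=
  k%:E * \int[g]_z (`|(z.1 : V) - (z.2 : V)|)%:E.
Proof.
have mE : measurable_fun setT
    (fun z : borel V * borel V => (`|(z.1 : V) - (z.2 : V)|)%:E).
  exact/measurable_EFinP.
pose c (z : borel V * borel V * Y) := k%:E * (`|(z.1.1 : V) - (z.1.2 : V)|)%:E.
have mc : measurable_fun setT c.
  by apply: measurable_funeM; exact: (measurableT_comp mE measurable_fst).
have c0 z : 0 <= c z by rewrite mule_ge0// lee_fin// ltW.
rewrite ge0_integral_distribution//.
apply: (@le_trans _ _ (\int[product_probability g rho]_z c z)).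
  apply: ge0_le_integral => //.
  - by move=> z _; rewrite lee_fin.
  - exact: (measurableT_comp mE mPsi).
  - by move=> z _; rewrite /c -EFinM lee_fin; exact: F_contract.
rewrite fubini_tonelli1// -ge0_integralZl//; last by rewrite lee_fin ltW.
rewrite (eq_integral (fun z : borel V * borel V =>
  k%:E * (`|(z.1 : V) - (z.2 : V)|)%:E))//.
move=> z _; rewrite /fubini_F/c/= integral_cst//.
by rewrite -[RHS]mule1; congr (_ * _); exact: probability_setT.
Qed.

End coupled.

(** Every coupling of [mu] and [nu] yields a coupling of the images at most [k] times as costly;
    [k0] lets [k] enter the infimum. *)
Lemma W1_random_map_contraction (k : R) (mu nu : probability (borel V) R) :
  (0 < k)%R ->
  (forall (x x' : V) y,
    (`|(F (x, y) : V) - (F (x', y) : V)| <= k * `|x - x'|)%R) ->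
  measurable_fun setT (fun z : borel V * borel V => `|(z.1 : V) - (z.2 : V)|%R) ->
  W1 (kact_prob mu P) (kact_prob nu P) <= k%:E * W1 mu nu.
Proof.
move=> k0 Fk mdist; rewrite /W1 -ereal_inf_pZl//.
apply: le_ereal_inf_tmp => _ [_ [g gmn <-] <-].
apply: le_trans (synchronous_coupling_cost g k0 Fk mdist).
apply: ereal_inf_lbound; exists (synchronous_coupling g) => //.
exact: synchronous_coupling_coupling.
Qed.

Lemma W1_random_map_contraction_iter (k : R) (mu nu : probability (borel V) R) n :
  (0 < k)%R ->
  (forall (x x' : V) y,
    (`|(F (x, y) : V) - (F (x', y) : V)| <= k * `|x - x'|)%R) ->
  measurable_fun setT (fun z : borel V * borel V => `|(z.1 : V) - (z.2 : V)|%R) ->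
  W1 (kact_iter mu P n) (kact_iter nu P n) <= (k ^+ n)%:E * W1 mu nu.
Proof.
move=> k0 Fk mdist; elim: n => [|n IHn]; first by rewrite expr0 mul1e.
apply: (le_trans (W1_random_map_contraction _ _ k0 Fk mdist)).
rewrite exprS EFinM -muleA; apply: lee_wpmul2l => //.
by rewrite lee_fin ltW.
Qed.

End random_map.

(** * The position update of pHMC *)

Section hilbert_coordinates.
Context {R : realType} {H : completeNormedModType R}.
Variable ip : {dot H for (@idfun R)}.
Hypothesis ip_norm : forall x, ip x x = `|x| ^+ 2.

Lemma inner_continuous (u : H) : continuous (ip^~ u).
Proof.
have E : ip^~ u = fun v => (`|v + u| ^+ 2 - `|v - u| ^+ 2) / 4.
  apply/funext => v; rewrite -!ip_norm sesquilinear.hnormD sesquilinear.hnormB.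
  by rewrite expr0 mul1r/=; field.
rewrite E => v; apply: cvgMl; apply: cvgB; under eq_fun do rewrite expr2.
  apply: cvgM; apply: cvg_norm; apply: cvgD; [exact: cvg_id|exact: cvg_cst|
    exact: cvg_id|exact: cvg_cst].
apply: cvgM; apply: cvg_norm; apply: cvgB; [exact: cvg_id|exact: cvg_cst|
  exact: cvg_id|exact: cvg_cst].
Qed.

(** The coordinates of v are continuous, but the map jumps to 0 outside H^l. Hence coordinate j is
    [x v j] times the indicator of [E], and [E] is measurable since membership means that some
    integer bounds all partial sums. *)
Lemma measurable_restrict_hs (phi : nat -> H) (l : R) :
  measurable_fun setT
    (restrict_hs ip phi l : borel H -> borel (hs R l)).
Proof.
pose x (v : H) j := ip v (phi j).
have mx j : measurable_fun setT (fun v : borel H => x v j).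
  apply: measurable_borel_real => U oU; apply: sub_sigma_algebra.
  by apply: open_comp => // v _; exact: inner_continuous.
pose S n (v : borel H) := series (hterm l (x v) (x v)) n.
have mS n : measurable_fun setT (S n).
  apply: measurable_sum => i.
  by apply: measurable_funM => //; apply: measurable_funM.
pose E : set (borel H) := [set v | x v \in in_hs l].
have mE : measurable E.
  have -> : E = \bigcup_(N : nat) \bigcap_n [set v | S n v <= N%:R].
    apply/seteqP; split=> [v Ev|v [N _ SN]]; last first.
      by apply: (@in_hs_bounded _ _ _ N%:R) => n; exact: SN.
    exists (Num.truncn (`|Hs Ev| ^+ 2)).+1 => // n _.
    apply: (le_trans (hterm_sum_le_norm (Hs Ev) n)).
    by apply/ltW; rewrite truncnS_gt.
  apply: bigcupT_measurable => N; apply: bigcapT_measurable => n.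
  rewrite (_ : [set _ | _] = S n @^-1` `]-oo, N%:R]%classic).
    by rewrite -[_ @^-1` _]setTI; exact: mS.
  by apply/seteqP; split=> v; rewrite /= in_itv.
apply: measurable_hs => j.
rewrite (_ : (fun v => _) = (fun v => x v j * \1_E v)).
  by apply: measurable_funM => //; exact: measurable_indic.
apply/funext => v; rewrite /restrict_hs /hs_of val_insubd indicE.
have -> : (v \in E) = (x v \in in_hs l).
  by apply/idP/idP => [/set_mem|h] //; exact: mem_set.
by case: ifP => _; rewrite ?mulr1 ?mulr0.
Qed.

End hilbert_coordinates.

(** The transport cost is integrated for the product sigma-algebra, where continuity of the distance
    yields measurability through separability. *)
Lemma measurable_hs_dist (R : realType) (s : R) : measurable_fun setT
  (fun z : borel (hs R s) * borel (hs R s) => `|(z.1 : hs R s) - (z.2 : hs R s)|).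
Proof.
apply: measurable_borel_real => U oU.
pose B : measurableType _ := borel (hs R s).
apply: (@measurable_continuous_pair R _ (B * B)%type (hs R s) (hs R s) R^o _ _
  (fun z => `|z.1 - z.2|) fst snd (@dense_hs_seq R s) (@dense_hs_seq R s) _ _ _ U oU).
- by move=> z; apply: cvg_norm; apply: cvgB; [exact: cvg_fst|exact: cvg_snd].
- exact: measurable_fst.
- exact: measurable_snd.
Qed.

Theorem corollary3p1 (R : realType) (H : completeNormedModType R)
    (ip : {dot H for (@idfun R)}) (C : {linear H -> H})
    (pi0 : probability (borel H) R) (phi : nat -> H) (lam : nat -> R)
    (kappa l L L' zeta M N_Phi T : R) (Phi : hs R l -> R)
    (flow : R -> hs R l * hs R l -> hs R l * hs R l)
    (P : R.-pker borel (hs R l) ~> borel (hs R l)) :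
  (* the Hilbert space H and the Gaussian measure N(0, C) *)
  (forall x, ip x x = `|x| ^+ 2) ->
  continuous C -> injective C ->
  centred_gaussian ip C pi0 ->
  orthonormal_basis ip phi ->
  (forall j, 0 < lam j /\ C (phi j) = lam j ^+ 2 *: phi j) ->
  (* (S1) *)
  1 / 2 < kappa ->
  (0 < limn_einf (fun j => (j.+1%:R `^ kappa * lam j)%:E))%E ->
  (limn_esup (fun j => (j.+1%:R `^ kappa * lam j)%:E) < +oo)%E ->
  (* (S2) *)
  0 <= l -> l < kappa - 1 / 2 ->
  continuous Phi -> (forall q, differentiable Phi q) ->
  (exists K : R, forall q q',
     `|grad Phi q - grad Phi q'| <= K * `|q - q'|) ->
  (* (S3) *)
  (forall e : R, 0 < e -> exists K : R, forall q,
     K - e * `|q| ^+ 2 <= Phi q) ->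
  (* (A1) *)
  0 < L -> 0 <= L' ->
  (forall q q', `|grad Phi q - grad Phi q'| <= L * `|q - q'|) ->
  (forall q q', `|cov_grad lam Phi q - cov_grad lam Phi q'| <= L * `|q - q'|) ->
  (forall q, `|grad Phi q| <= L * `|q| + L') ->
  (forall q, `|cov_grad lam Phi q| <= L * `|q| + L') ->
  (* (A2) *)
  0 < zeta -> zeta <= L + 1 ->
  (forall x y : hs R l, zeta * `|x - y| ^+ 2 <=
     hdot (x - y) (x - y) +
     hdot (cov_grad lam Phi x - cov_grad lam Phi y) (x - y)) ->
  (* (A3) *)
  is_C 4 Phi ->
  (forall x y h : hs R l,
     `|'d (grad Phi) x h - 'd (grad Phi) y h| <= M * `|x - y| * `|h|) ->
  (forall x y h : hs R l,
     `|cov_act lam l ('d (grad Phi) x h) - cov_act lam l ('d (grad Phi) y h)|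
       <= M * `|x - y| * `|h|) ->
  (forall x h1 h2 h3 h4 : hs R l,
     `|iter_fderiv Phi 4 x h1 h2 h3 h4| <=
       N_Phi * (`|h1| * `|h2| * `|h3| * `|h4|)) ->
  (* exact preconditioned HMC with integration time T *)
  hamiltonian_flow lam Phi flow ->
  0 < T -> T ^+ 2 * (L + 1) <= zeta / (L + 1) ->
  pHMC_kernel ip phi pi0 flow T P ->
  forall (mu nu : probability (borel (hs R l)) R) (n : nat),
    (W1 (kact_iter mu P n) (kact_iter nu P n) <=
       ((1 - 1 / 27 * zeta * T ^+ 2) ^+ n)%:E * W1 mu nu)%E.
Proof.
move=> ip_norm _ _ _ _ _ _ _ _ _ _ _ _ _ _ L0 _ _ cov_lip _ _ zeta0 zetaL mono
  _ _ _ _ flowP T0 hT PP mu nu n.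
have K0 : 0 < L + 1 by rewrite addr_gt0.
have KT : (L + 1) ^+ 2 * T ^+ 2 <= zeta.
  rewrite ler_pdivlMr// in hT; apply: le_trans hT; rewrite le_eqVlt.
  by apply/orP; left; apply/eqP; ring.
(* [zetaL] makes zeta / (L + 1) at most 1. *)
have LT1 : (L + 1) * T ^+ 2 <= 1.
  by rewrite mulrC (le_trans hT)// ler_pdivrMr// mul1r.
have zT1 : zeta * T ^+ 2 <= 1.
  by apply: le_trans LT1; rewrite ler_wpM2r ?sqr_ge0.
pose F (z : borel (hs R l) * borel H) : borel (hs R l) :=
  (flow T (z.1, restrict_hs ip phi l z.2)).1.
apply: (@W1_random_map_contraction_iter _ _ _ _ pi0 F P).
- apply: measurable_borel => U oU.
  pose X : measurableType _ := (borel (hs R l) * borel H)%type.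
  apply: (@measurable_continuous_pair R _ X (hs R l) (hs R l) (hs R l) _ _
    (fun a => (flow T a).1) fst (fun z => restrict_hs ip phi l z.2)
    (@dense_hs_seq R l) (@dense_hs_seq R l) _ _ _ U oU).
  + exact: (flow_position_continuous flowP L0 T0 LT1 cov_lip).
  + exact: measurable_fst.
  + exact: (measurableT_comp (measurable_restrict_hs ip_norm phi (l := l))
      measurable_snd).
- by move=> x A mA; exact: PP.
(* The contraction factor is at least 26/27, by [zT1]. *)
- lra.
- move=> x x' v.
  exact: (flow_contraction flowP L0 T0 LT1 cov_lip zeta0 mono _ _ _ KT zT1).
- exact: measurable_hs_dist.
Qed.
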